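(* For any $k\ge 1$ and any natural numbers $n_1,\dots,n_k$, not all zero, $$\rho(\mathrm{Tr}([n_1]\times\dots\times[n_k])) = \frac{\sum_{0\le x_1\le y_1\le z_1\le n_1}\cdots\sum_{0\le x_k\le y_k\le z_k\le n_k}\left(\prod_{i=1}^k (z_i-x_i+1)-\prod_{i=1}^k(z_i-y_i+1)\right)}{\left(\sum_{0\le x_1\le n_1}\cdots\sum_{0\le x_k\le n_k}\left(\left(\prod_{i=1}^k(n_i-x_i+1)\right)-1\right)\right)^2}.$$ In particular, $$\rho(\mathrm{Tr}([n]))=\frac{(n+2)(n+3)}{6n(n+1)}\quad (n\ge 1),$$ $$\rho(\mathrm{Tr}([n]\times[m]))=\frac{(m+2)(m+3)(n+2)(n+3)(3mn+4m+4n)}{36(m+1)(n+1)(2m+2n+mn)^2}\quad (n,m \text{ natural numbers, not both zero}),$$ $$\rho(\mathrm{Tr}([1]^k))=\frac{6^k-5^k}{(3^k-2^k)^2}\quad (k\ge 1).$$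
   Context: $[n]$ denotes the totally ordered lattice $\{0<1<\dots<n\}$, and products of lattices carry the componentwise order. (If $N=p_1^{n_1}\cdots p_k^{n_k}$ is a prime factorization, the subgroup lattice of the cyclic group $C_N$ is $[n_1]\times\dots\times[n_k]$, with trivial conjugation action.) A transfer system on a lattice $L$ (with trivial group action) is a partial order $\to$ on the set $L$ such that $x\to y$ implies $x\le y$, and whenever $x\to y$ and $x'\le y$, we have $x\wedge x'\to x'$. $\mathrm{Tr}(L)$ denotes the set of transfer systems on $L$ ordered by inclusion; it is a complete lattice. For a finite lattice $P$ with at least two elements, let $J(P)$ and $M(P)$ be its sets of join-irreducible and meet-irreducible elements (the minimum element is not join-irreducible, and the maximum element is not meet-irreducible); the codensity of $P$ is $$\rho(P)=\frac{|\{(A,B)\in J(P)\times M(P): A\not\le B\}|}{|J(P)|\,|M(P)|}.$$ *)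

(* Defs.v *)
From HB Require Import structures.
From mathcomp Require Import all_boot all_order all_algebra.

Set Implicit Arguments.
Unset Strict Implicit.
Unset Printing Implicit Defensive.

Import Order.TTheory.

Local Open Scope order_scope.

(* [n] is the ordinal type 'I_n.+1 with its library order. The product of a
   family [n 0], ..., [n (k-1)] is the type of dependent finite functions
   below; it coerces to functions, so that x i : 'I_(n i).+1. *)
Definition chain_prod (k : nat) (n : 'I_k -> nat) :=
  {dffun forall i : 'I_k, 'I_(n i).+1}.

Section ChainProd.
Context {k : nat} {n : 'I_k -> nat}.
Implicit Types x y z : chain_prod n.

HB.instance Definition _ := Finite.on (chain_prod n).

Definition chain_le x y := [forall i, x i <= y i].
Definition chain_meet x y : chain_prod n := [ffun i => x i `&` y i].
Definition chain_join x y : chain_prod n := [ffun i => x i `|` y i].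

Fact chain_le_refl : reflexive chain_le.
Proof. by move=> x; apply/forallP => i. Qed.

Fact chain_le_anti : antisymmetric chain_le.
Proof.
move=> x y /andP[/forallP xy /forallP yx]; apply/ffunP => i.
by apply/le_anti; rewrite xy yx.
Qed.

Fact chain_le_trans : transitive chain_le.
Proof.
move=> y x z /forallP xy /forallP yz; apply/forallP => i.
exact: le_trans (xy i) (yz i).
Qed.

Fact chain_display : Order.disp_t. Proof. exact: Order.Disp tt tt. Qed.

HB.instance Definition _ := Order.Le_isPOrder.Build chain_display
  (chain_prod n) chain_le_refl chain_le_anti chain_le_trans.

Fact chain_meetP x y z : (x <= chain_meet y z) = (x <= y) && (x <= z).
Proof.
apply/forallP/andP => [h|[/forallP xy /forallP xz] i]; last first.
  by rewrite ffunE lexI xy xz.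
by split; apply/forallP => i; have:= h i; rewrite ffunE lexI => /andP[].
Qed.

Fact chain_joinP x y z : (chain_join x y <= z) = (x <= z) && (y <= z).
Proof.
apply/forallP/andP => [h|[/forallP xz /forallP yz] i]; last first.
  by rewrite ffunE leUx xz yz.
by split; apply/forallP => i; have:= h i; rewrite ffunE leUx => /andP[].
Qed.

HB.instance Definition _ := Order.POrder_MeetJoin_isLattice.Build
  chain_display (chain_prod n) chain_meetP chain_joinP.

Lemma leEchain x y : (x <= y) = [forall i, x i <= y i].
Proof. by []. Qed.

End ChainProd.

(* A relation on L is encoded by its graph. *)
Definition is_transfer d (L : finLatticeType d) (T : {set L * L}) : bool :=
  let R x y := (x, y) \in T in
  [&& [forall x, R x x],
      [forall x, forall y, R x y && R y x ==> (x == y)],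
      [forall x, forall y, forall z, R x y && R y z ==> R x z],
      [forall x, forall y, R x y ==> (x <= y)] &
      [forall x, forall y, forall x', R x y && (x' <= y) ==> R (x `&` x') x']].

Record Tr d (L : finLatticeType d) : predArgType :=
  MkTr { tr_graph :> {set L * L}; _ : is_transfer tr_graph }.

Section TrLattice.
Context {d : Order.disp_t} {L : finLatticeType d}.
Implicit Types A B C : Tr L.

HB.instance Definition _ := [isSub for @tr_graph d L].
HB.instance Definition _ := [Finite of Tr L by <:].

Lemma is_transferP (T : {set L * L}) :
  reflect [/\ forall x, (x, x) \in T,
              forall x y, (x, y) \in T -> (y, x) \in T -> x = y,
              forall x y z, (x, y) \in T -> (y, z) \in T -> (x, z) \in T,
              forall x y, (x, y) \in T -> x <= y &
              forall x y x', (x, y) \in T -> x' <= y -> (x `&` x', x') \in T]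
          (is_transfer T).
Proof.
apply: (iffP and5P) => -[r a t l c]; split.
- exact/forallP.
- by move=> x y xy yx; move/forallP/(_ x)/forallP/(_ y): a; rewrite xy yx => /eqP.
- move=> x y z xy yz; move/forallP/(_ x)/forallP/(_ y)/forallP/(_ z): t.
  by rewrite xy yz.
- by move=> x y; apply/implyP; move/forallP/(_ x)/forallP/(_ y): l.
- move=> x y x' xy x'y; move/forallP/(_ x)/forallP/(_ y)/forallP/(_ x'): c.
  by rewrite xy x'y.
- exact/forallP.
- apply/forallP=> x; apply/forallP=> y; apply/implyP => /andP[xy yx].
  by apply/eqP; exact: a.
- apply/forallP=> x; apply/forallP=> y; apply/forallP=> z.
  by apply/implyP => /andP[]; exact: t.
- by apply/forallP=> x; apply/forallP=> y; apply/implyP; exact: l.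
- apply/forallP=> x; apply/forallP=> y; apply/forallP=> z.
  by apply/implyP => /andP[]; exact: c.
Qed.

Lemma tr_transferP A :
  [/\ forall x, (x, x) \in (A : {set _}),
      forall x y, (x, y) \in (A : {set _}) -> (y, x) \in (A : {set _}) -> x = y,
      forall x y z, (x, y) \in (A : {set _}) -> (y, z) \in (A : {set _}) ->
        (x, z) \in (A : {set _}),
      forall x y, (x, y) \in (A : {set _}) -> x <= y &
      forall x y x', (x, y) \in (A : {set _}) -> x' <= y ->
        (x `&` x', x') \in (A : {set _})].
Proof. exact/is_transferP/(valP A). Qed.

Fact tr_top_subproof : is_transfer [set p : L * L | p.1 <= p.2].
Proof.
apply/is_transferP; split => [x|x y|x y z|x y|x y x']; rewrite !inE //=.
- by move=> xy yx; apply/le_anti; rewrite xy.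
- exact: le_trans.
- by rewrite leIr.
Qed.
Definition tr_top : Tr L := MkTr tr_top_subproof.

Fact tr_bot_subproof : is_transfer [set p : L * L | p.1 == p.2].
Proof.
apply/is_transferP; split => [x|x y|x y z|x y|x y x'];
  rewrite !inE //=.
- by move=> /eqP.
- by move=> /eqP -> /eqP ->.
- by move=> /eqP ->.
- by move=> /eqP -> x'y; rewrite meetC (meet_idPl x'y).
Qed.
Definition tr_bot : Tr L := MkTr tr_bot_subproof.

(* Intersecting with the top element makes this correct for empty families. *)
Fact tr_bigmeet_subproof (P : pred (Tr L)) :
  is_transfer (tr_top :&: \bigcap_(C | P C) C).
Proof.
have [r a t l c] := tr_transferP tr_top.
apply/is_transferP; split => [x|x y|x y z|x y|x y x'].
- rewrite inE r; apply/bigcapP => C _.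
  by have [rC _ _ _ _] := tr_transferP C.
- by move=> /setIP[xy _] /setIP[yx _]; exact: a.
- move=> /setIP[xy /bigcapP h] /setIP[yz /bigcapP h'].
  rewrite inE (t _ _ _ xy yz); apply/bigcapP => C PC.
  by have [_ _ tC _ _] := tr_transferP C; exact: tC (h C PC) (h' C PC).
- by move=> /setIP[xy _]; exact: l.
- move=> /setIP[xy /bigcapP h] x'y; rewrite inE (c _ _ _ xy x'y).
  apply/bigcapP => C PC.
  by have [_ _ _ _ cC] := tr_transferP C; exact: cC (h C PC) x'y.
Qed.
Definition tr_bigmeet P : Tr L := MkTr (tr_bigmeet_subproof P).

Definition tr_le A B := A \subset B.
Definition tr_meet A B := tr_bigmeet (pred2 A B).
Definition tr_join A B :=
  tr_bigmeet [pred C : Tr L | (A \subset C) && (B \subset C)].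

Fact tr_le_refl : reflexive tr_le.
Proof. by move=> A; exact: subxx. Qed.

Fact tr_le_anti : antisymmetric tr_le.
Proof.
by move=> A B AB; apply/val_inj/eqP; rewrite eqEsubset.
Qed.

Fact tr_le_trans : transitive tr_le.
Proof. by move=> B A C; exact: subset_trans. Qed.

Fact tr_display : Order.disp_t. Proof. exact: Order.Disp tt tt. Qed.

HB.instance Definition _ := Order.Le_isPOrder.Build tr_display (Tr L)
  tr_le_refl tr_le_anti tr_le_trans.

Lemma leETr A B : (A <= B) = (A \subset B).
Proof. by []. Qed.

Fact tr_lex1 A : A <= tr_top.
Proof.
apply/subsetP => -[x y] xy; rewrite inE /=.
by have [_ _ _ l _] := tr_transferP A; exact: l.
Qed.

Fact tr_le0x A : tr_bot <= A.
Proof.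
apply/subsetP => -[x y]; rewrite inE => /eqP /= ->.
by have [r _ _ _ _] := tr_transferP A; exact: r.
Qed.

Fact tr_bigmeetP A (P : pred (Tr L)) :
  reflect (forall C, P C -> A <= C) (A <= tr_bigmeet P).
Proof.
apply: (iffP idP) => [AP C PC|AP].
  apply/(subset_trans AP)/subsetP => p /setIP[_ /bigcapP]; exact.
apply/subsetP => p pA; rewrite inE (subsetP (tr_lex1 A)) //=.
by apply/bigcapP => C PC; exact: (subsetP (AP C PC)).
Qed.

Fact tr_meetP A B C : (A <= tr_meet B C) = (A <= B) && (A <= C).
Proof.
apply/tr_bigmeetP/andP => [h|[AB AC] D /orP[]/eqP-> //].
by split; apply: h; rewrite /= eqxx ?orbT.
Qed.

Fact tr_joinP A B C : (tr_join A B <= C) = (A <= C) && (B <= C).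
Proof.
have ubA : A <= tr_join A B by apply/tr_bigmeetP => D /andP[].
have ubB : B <= tr_join A B by apply/tr_bigmeetP => D /andP[].
apply/idP/idP => [h|h]; first by rewrite (le_trans ubA h) (le_trans ubB h).
by have /tr_bigmeetP := lexx (tr_join A B); apply.
Qed.

HB.instance Definition _ := Order.POrder_MeetJoin_isLattice.Build
  tr_display (Tr L) tr_meetP tr_joinP.
HB.instance Definition _ := Order.hasBottom.Build tr_display (Tr L) tr_le0x.
HB.instance Definition _ := Order.hasTop.Build tr_display (Tr L) tr_lex1.

End TrLattice.

Section Codensity.
Context {d : Order.disp_t} (P : finTBLatticeType d).

Definition join_irreducible (x : P) : bool :=
  (x != \bot) &&
  [forall a : P, forall b : P, (x == a `|` b) ==> (x == a) || (x == b)].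

Definition meet_irreducible (x : P) : bool :=
  (x != \top) &&
  [forall a : P, forall b : P, (x == a `&` b) ==> (x == a) || (x == b)].

Definition join_irreducibles : {set P} := [set x | join_irreducible x].
Definition meet_irreducibles : {set P} := [set x | meet_irreducible x].

(* On the one-element lattice, where there are no irreducibles, the value is
   the junk 0 / 0 = 0. *)
Definition codensity : rat :=
  (#|[set AB : P * P in setX join_irreducibles meet_irreducibles
       | ~~ (AB.1 <= AB.2)%O]|%:R
     / (#|join_irreducibles|%:R * #|meet_irreducibles|%:R))%R.

End Codensity.
Arguments codensity {d} P.

(* Main.v *)
Require Import Defs.
From mathcomp Require Import all_boot all_order all_algebra.
From mathcomp Require Import ring.

Set Implicit Arguments.
Unset Strict Implicit.
Unset Printing Implicit Defensive.

Import Order.TTheory GRing.Theory Num.Theory.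

(** The proof identifies both kinds of irreducibles of Tr(L), for any finite
lattice L, with the strict pairs x < y of L, and then counts.

The smallest transfer system containing x -> y is
  gen(x,y) = equality + {x /\ z -> z | z <= y},
and every transfer system is the join of those it contains.  Dually, the
arrows a -> b with the right lifting property against x <= y, that is
  x <= a and y <= b imply y <= a,
form a transfer system cogen(x,y).  Every transfer system is the meet of the
cogen(x,y) above it: an inequality a <= b factors as a <= m -> b with m least
such that m -> b is in T, the whole of T lifts against a <= m, and a -> b does
not unless a = m ([tr_meet_cogen]).  This is the correspondence between
transfer systems and weak factorization systems, and it lets one argue without
assuming that L is self-dual.

For x < y the two systems are tied by an arrow relation: gen(x,y) is not below
cogen(x,y), but everything strictly below gen(x,y) is below cogen(x,y)
([lt_tr_gen]), and everything strictly above cogen(x,y) is above gen(x,y)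
([tr_cogen_lt]).  Hence the first is join-irreducible, the second is
meet-irreducible, and the two families of generators leave room for no other
irreducible.  So |J| = |M| is the number of strict pairs.

Since gen(a,z) <= cogen(x,y) exactly when a -> z lifts against x <= y, the
numerator of the codensity counts the squares x <= a <= z, x <= y <= z with
y <= a false.  For fixed x <= y <= z these a form [x,z] minus [y,z], whence
[codensity_Tr]:
  numerator = sum over x <= y <= z of |[x,z]| - |[y,z]|.

Intervals of a product of chains have product cardinality, which is the
general formula.  The three closed forms follow because both halves of the
numerator, and the number of pairs x <= y, are multiplicative in L, so that
only single chains have to be summed ([span_sum_ord], [upper_sum_ord],
[up_sum_ord]). *)

(** * Irreducible elements of a finite lattice *)

Section Irreducible.
Context {d : Order.disp_t} {P : finTBLatticeType d}.
Local Open Scope order_scope.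
Implicit Types (j m a : P) (I : finType).

Lemma join_irreducible_bigjoin I (Q : pred I) (f : I -> P) j :
  join_irreducible j -> j = \join_(i | Q i) f i -> exists2 i, Q i & j = f i.
Proof.
case/andP=> j0 /forallP jI.
elim/big_rec: _ => [jE|i a Qi IH jE]; first by rewrite jE eqxx in j0.
move/forallP/(_ a): (jI (f i)); rewrite -jE eqxx /=.
by case/orP=> /eqP; [exists i | exact: IH].
Qed.

Lemma meet_irreducible_bigmeet I (Q : pred I) (f : I -> P) m :
  meet_irreducible m -> m = \meet_(i | Q i) f i -> exists2 i, Q i & m = f i.
Proof.
case/andP=> m1 /forallP mI.
elim/big_rec: _ => [mE|i a Qi IH mE]; first by rewrite mE eqxx in m1.
move/forallP/(_ a): (mI (f i)); rewrite -mE eqxx /=.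
by case/orP=> /eqP; [exists i | exact: IH].
Qed.

(** If j is not below m but everything strictly below j is, then a join of
elements strictly below j stays below m and cannot reach j. *)
Lemma join_irreducible_arrow j m :
  ~~ (j <= m) -> (forall a, a < j -> a <= m) -> join_irreducible j.
Proof.
move=> jm jP; apply/andP; split.
  by apply: contraNneq jm => ->; exact: le0x.
apply/forallP=> a; apply/forallP=> b; apply/implyP=> /eqP jE.
have [aj bj] : a <= j /\ b <= j by rewrite jE leUl leUr.
apply: contraNT jm; rewrite negb_or => /andP[ja jb].
by rewrite {1}jE leUx !jP // lt_neqAle ?aj ?bj eq_sym ?ja ?jb.
Qed.

Lemma meet_irreducible_arrow j m :
  ~~ (j <= m) -> (forall a, m < a -> j <= a) -> meet_irreducible m.
Proof.
move=> jm mP; apply/andP; split.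
  by apply: contraNneq jm => ->; exact: lex1.
apply/forallP=> a; apply/forallP=> b; apply/implyP=> /eqP mE.
have [ma mb] : m <= a /\ m <= b by rewrite mE leIl leIr.
apply: contraNT jm; rewrite negb_or => /andP[na nb].
by rewrite mE lexI !mP // lt_neqAle ?ma ?mb ?na ?nb.
Qed.

End Irreducible.

(** * Irreducible transfer systems *)

Section TransferIrreducibles.
Context {d : Order.disp_t} {L : finLatticeType d}.
Local Open Scope order_scope.
Implicit Types (p q : L * L) (T : Tr L).

(** The restrictions of x -> y, together with the identities, are already closed
under composition: if b = x /\ c then restricting x -> y to b gives back b
itself, so two such arrows never compose to a new one. *)
Fact tr_gen_subproof p : is_transfer
  [set r : L * L | (r.1 == r.2) || (r.2 <= p.2) && (r.1 == p.1 `&` r.2)].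
Proof.
case: p => x y; apply/is_transferP; split => [a|a b|a b c|a b|a b c];
  rewrite !inE ?eqxx //=.
- case/orP=> [/eqP //|/andP[_ /eqP aE]] /orP[/eqP //|/andP[_ /eqP bE]].
  by apply/le_anti; rewrite {1}aE leIr bE leIr.
- case/orP=> [/eqP-> //|/andP[b_y /eqP aE]].
  case/orP=> [/eqP<-|/andP[cy /eqP bE]]; first by rewrite b_y aE eqxx orbT.
  by rewrite cy aE bE meetA meetxx eqxx orbT.
- by case/orP=> [/eqP->|/andP[_ /eqP->]]; rewrite ?lexx ?leIr.
- case/orP=> [/eqP-> cb|/andP[b_y /eqP-> cb]].
    by rewrite (meet_idPr cb) eqxx.
  by rewrite (le_trans cb b_y) -meetA (meet_idPr cb) eqxx orbT.
Qed.
Definition tr_gen p : Tr L := MkTr (tr_gen_subproof p).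

(** Right lifting against x <= y, written out in a poset: a square from x <= y
to a <= b has a diagonal exactly when y <= a.  Composition and restriction
hold as for any class of maps defined by right lifting. *)
Fact tr_cogen_subproof p : is_transfer
  [set r : L * L | (r.1 <= r.2) &&
                   ((p.1 <= r.1) && (p.2 <= r.2) ==> (p.2 <= r.1))].
Proof.
case: p => x y; apply/is_transferP; split => [a|a b|a b c|a b|a b c];
  rewrite !inE //=.
- by rewrite lexx /=; apply/implyP=> /andP[].
- by move=> /andP[ab _] /andP[ba _]; apply/le_anti; rewrite ab ba.
- move=> /andP[ab /implyP Rab] /andP[bc /implyP Rbc].
  rewrite (le_trans ab bc); apply/implyP=> /andP[xa yc]; apply: Rab.
  by rewrite xa Rbc // (le_trans xa ab).
- by case/andP.
- case/andP=> ab /implyP Rab cb; rewrite leIr /=.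
  apply/implyP; rewrite !lexI => /andP[/andP[xa xc] yc].
  by rewrite yc Rab // xa (le_trans yc cb).
Qed.
Definition tr_cogen p : Tr L := MkTr (tr_cogen_subproof p).

Lemma in_tr_gen p r : (r \in (tr_gen p : {set _})) =
  (r.1 == r.2) || (r.2 <= p.2) && (r.1 == p.1 `&` r.2).
Proof. by rewrite inE. Qed.

Lemma in_tr_cogen p r : (r \in (tr_cogen p : {set _})) =
  (r.1 <= r.2) && ((p.1 <= r.1) && (p.2 <= r.2) ==> (p.2 <= r.1)).
Proof. by rewrite inE. Qed.

Lemma mem_tr_gen p : p.1 <= p.2 -> p \in (tr_gen p : {set _}).
Proof. by move=> /meet_idPl pE; rewrite in_tr_gen lexx pE eqxx orbT. Qed.

Lemma tr_gen_le p T : p.1 <= p.2 -> (tr_gen p <= T) = (p \in (T : {set _})).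
Proof.
move=> ple; have [r _ _ _ c] := tr_transferP T.
apply/idP/idP => [/subsetP|pT]; first by apply; exact: mem_tr_gen.
apply/subsetP=> -[a b]; rewrite in_tr_gen /=.
case/orP=> [/eqP-> //|/andP[bp /eqP->]]; apply: c bp.
by rewrite -surjective_pairing.
Qed.

Lemma tr_gen_le_cogen p q : p.1 <= p.2 ->
  (tr_gen p <= tr_cogen q) =
  ~~ [&& q.1 <= p.1, q.2 <= p.2 & ~~ (q.2 <= p.1)].
Proof.
move=> ple; rewrite tr_gen_le // in_tr_cogen ple /=.
by case: (q.1 <= _) => //; case: (q.2 <= _) => //=; rewrite negbK.
Qed.

(** The square of a strict pair with itself has no diagonal. *)
Lemma tr_gen_not_le_cogen p : p.1 < p.2 -> ~~ (tr_gen p <= tr_cogen p).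
Proof.
move=> plt; rewrite tr_gen_le_cogen ?(ltW plt) // negbK !lexx /=.
by rewrite lt_geF.
Qed.

(** An arrow a -> b failing to lift against x <= y has y <= b; if it is also a
nontrivial restriction of x -> y then b = y, so it is x -> y itself. *)
Lemma lt_tr_gen p T : p.1 < p.2 -> T < tr_gen p -> T <= tr_cogen p.
Proof.
move=> plt Tlt; have [_ _ _ l _] := tr_transferP T.
have pT : p \notin (T : {set _}).
  by rewrite -tr_gen_le ?(ltW plt) // lt_geF.
apply/subsetP=> -[a b] abT; rewrite in_tr_cogen /= (l _ _ abT) /=.
have := subsetP (ltW Tlt) _ abT; rewrite in_tr_gen /=.
apply: contraTT; rewrite negb_imply => /andP[/andP[xa yb] ya].
rewrite negb_or; apply/andP; split.
  by apply: contraNneq ya => ->.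
apply: contra pT => /andP[b_y /eqP aE].
have bE : b = p.2 by apply/le_anti; rewrite b_y yb.
by move: abT; rewrite aE bE (meet_idPl (ltW plt)) -surjective_pairing.
Qed.

(** An arrow a -> b of T outside cogen(x,y) restricts along y <= b to
a /\ y -> y with x <= a /\ y < y.  The pair x <= a /\ y lifts against x <= y
because y is not below a /\ y, so it lies in T, and composing gives x -> y. *)
Lemma tr_cogen_lt p T : p.1 < p.2 -> tr_cogen p < T -> tr_gen p <= T.
Proof.
move=> plt ltT; have [_ _ t l c] := tr_transferP T.
rewrite tr_gen_le ?(ltW plt) //.
have [[a b] abT] : exists2 r,
    r \in (T : {set _}) & r \notin (tr_cogen p : {set _}).
  by apply/subsetPn; rewrite -leETr lt_geF.
rewrite in_tr_cogen /= (l _ _ abT) negb_imply /= => /andP[/andP[xa yb] ya].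
have ay := c _ _ _ abT yb.
rewrite [p]surjective_pairing; apply: (t _ (a `&` p.2)) ay.
apply: (subsetP (ltW ltT)); rewrite in_tr_cogen /=.
by rewrite !lexI xa (ltW plt) (negPf ya) andbF.
Qed.

Lemma tr_gen_inj : {in [pred p | p.1 < p.2] &, injective tr_gen}.
Proof.
move=> p q; rewrite !inE => plt qlt eq_pq.
have := mem_tr_gen (ltW plt); rewrite eq_pq in_tr_gen lt_eqF //=.
have := mem_tr_gen (ltW qlt); rewrite -eq_pq in_tr_gen lt_eqF //=.
move=> /andP[qp /eqP q1] /andP[pq /eqP p1].
have e2 : p.2 = q.2 by apply/le_anti; rewrite pq qp.
rewrite [p]surjective_pairing [q]surjective_pairing e2; congr pair.
by rewrite p1 e2 (meet_idPl (ltW qlt)).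
Qed.

Lemma tr_cogen_inj : {in [pred p | p.1 < p.2] &, injective tr_cogen}.
Proof.
move=> p q; rewrite !inE => plt qlt eq_pq.
have := tr_gen_not_le_cogen plt; rewrite eq_pq tr_gen_le_cogen ?(ltW plt) //.
have := tr_gen_not_le_cogen qlt; rewrite -eq_pq tr_gen_le_cogen ?(ltW qlt) //.
rewrite !negbK => /and3P[p1q1 p2q2 _] /and3P[q1p1 q2p2 _].
rewrite [p]surjective_pairing [q]surjective_pairing; congr pair.
  by apply/le_anti; rewrite p1q1 q1p1.
by apply/le_anti; rewrite p2q2 q2p2.
Qed.

(** Generators from strict pairs suffice: the identity arrows belong to every
transfer system, including the join. *)
Lemma tr_join_gen T :
  T = \join_(p : L * L | (p.1 < p.2) && (p \in (T : {set _}))) tr_gen p.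
Proof.
have [r _ _ l _] := tr_transferP T.
apply/le_anti/andP; split; last first.
  by apply/joinsP=> p /andP[plt pT]; rewrite tr_gen_le // ltW.
set J := \join_(p | _) _; have [rJ _ _ _ _] := tr_transferP J.
apply/subsetP=> -[a b] abT; have [-> //|ab] := eqVneq a b.
have ablt : a < b by rewrite lt_neqAle ab l.
rewrite -[_ \in _](@tr_gen_le (a, b)) ?(ltW ablt) //.
by apply: (@joins_sup _ _ _ (a, b)); rewrite /= ablt abT.
Qed.

(** The sources of the T-arrows into b are closed under meets, hence have a least
element above a; it is found by minimizing the size of its down-set. *)
Lemma tr_factor T a b : a <= b -> exists m,
  [/\ a <= m, (m, b) \in (T : {set _}) &
      forall c, a <= c -> (c, b) \in (T : {set _}) -> m <= c].
Proof.
move=> ab; have [r _ t l c] := tr_transferP T.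
pose Q := [pred m | (a <= m) && ((m, b) \in (T : {set _}))].
have Qb : Q b by rewrite /= ab r.
case: (arg_minnP (fun m => #|[pred z | z <= m]|) Qb) => m /andP[am mb] mmin.
exists m; split=> // e ae eb; have cm : (e `&` m, b) \in (T : {set _}).
  exact: t (c _ _ _ eb (l _ _ mb)) mb.
have := mmin (e `&` m); rewrite /= cm lexI ae am => /(_ isT) card_le.
have sub : [pred z | z <= e `&` m] \subset [pred z | z <= m].
  by apply/subsetP=> z; rewrite !inE lexI => /andP[].
have /subsetP/(_ m) : [pred z | z <= m] \subset [pred z | z <= e `&` m].
  by rewrite -(geq_leqif (subset_leqif_card sub)).
by rewrite !inE lexx lexI => /(_ isT)/andP[].
Qed.

Lemma tr_meet_cogen T :
  T = \meet_(p : L * L | (p.1 < p.2) && (T <= tr_cogen p)) tr_cogen p.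
Proof.
have [r _ t l c] := tr_transferP T.
apply/le_anti/andP; split; first by apply/meetsP=> p /andP[].
set M := \meet_(p | _) _; have [_ _ _ lM _] := tr_transferP M.
apply/subsetP=> -[a b] abM; have ab := lM _ _ abM.
(* If a < m, the pair (a, m) is one of those defining M, but a -> b does not
   lift against it; so a = m and a -> b is in T. *)
have [m [am mb mmin]] := tr_factor T ab.
have [amE|a_neq_m] := eqVneq a m; first by rewrite amE.
have altm : a < m by rewrite lt_neqAle a_neq_m.
have Tam : T <= tr_cogen (a, m).
  apply/subsetP=> -[e f] ef; rewrite in_tr_cogen /= (l _ _ ef) /=.
  apply/implyP=> /andP[ae mf].
  have /mmin: (e `&` m, b) \in (T : {set _}) by exact: t (c _ _ _ ef mf) mb.
  by rewrite !lexI ae am => /(_ isT)/andP[].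
have : M <= tr_cogen (a, m).
  by apply: (@meets_inf _ _ _ (a, m)); rewrite /= altm Tam.
move/subsetP/(_ _ abM); rewrite in_tr_cogen /= lexx (l _ _ mb) ab /=.
by rewrite lt_geF.
Qed.

Lemma join_irreducibles_Tr :
  join_irreducibles (Tr L) = tr_gen @: [set p | p.1 < p.2].
Proof.
apply/setP=> A; rewrite inE; apply/idP/imsetP => [Airr|[p]].
  have [p /andP[plt _] ->] := join_irreducible_bigjoin Airr (tr_join_gen A).
  by exists p; rewrite // inE.
rewrite inE => plt ->.
apply: join_irreducible_arrow (tr_gen_not_le_cogen plt) _.
by move=> T; exact: lt_tr_gen.
Qed.

Lemma meet_irreducibles_Tr :
  meet_irreducibles (Tr L) = tr_cogen @: [set p | p.1 < p.2].
Proof.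
apply/setP=> A; rewrite inE; apply/idP/imsetP => [Airr|[p]].
  have [p /andP[plt _] ->] := meet_irreducible_bigmeet Airr (tr_meet_cogen A).
  by exists p; rewrite // inE.
rewrite inE => plt ->.
apply: meet_irreducible_arrow (tr_gen_not_le_cogen plt) _.
by move=> T; exact: tr_cogen_lt.
Qed.

(** The squares from x <= y to a <= z without a diagonal, stored as
((a, z), (x, y)). *)
Definition nonlifting_squares : {set (L * L) * (L * L)} :=
  [set r | [&& r.1.1 <= r.1.2, r.2.1 <= r.2.2,
               r.2.1 <= r.1.1, r.2.2 <= r.1.2 & ~~ (r.2.2 <= r.1.1)]].

(** A square with a degenerate side always has a diagonal, so the squares without
one are exactly the pairs of strict pairs with gen not below cogen. *)
Lemma codensity_Tr_card : codensity (Tr L) =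
  (#|nonlifting_squares|%:R
   / (#|[set p : L * L | (p.1 < p.2)%O]|%:R ^+ 2))%R.
Proof.
have ltP (p : L * L) : p \in [set p | p.1 < p.2] -> p \in [pred p | p.1 < p.2].
  by rewrite !inE.
have injg : {in [set p | p.1 < p.2] &, injective tr_gen}.
  by move=> p q /ltP pl /ltP ql; exact: tr_gen_inj.
have injc : {in [set p | p.1 < p.2] &, injective tr_cogen}.
  by move=> p q /ltP pl /ltP ql; exact: tr_cogen_inj.
rewrite /codensity join_irreducibles_Tr meet_irreducibles_Tr.
rewrite !card_in_imset // -expr2; congr (_%:R / _)%R.
set D := nonlifting_squares.
have Dlt r : r \in D ->
    [/\ r.1.1 < r.1.2, r.2.1 < r.2.2 & ~~ (tr_gen r.1 <= tr_cogen r.2)].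
  rewrite inE => /and5P[ab xy xa yb ya]; split.
  - by rewrite lt_neqAle ab andbT; apply: contraNneq ya => ->.
  - by rewrite lt_neqAle xy andbT; apply: contraNneq ya => <-.
  - by rewrite tr_gen_le_cogen // xa yb ya.
rewrite -(@card_in_imset _ _ (fun r => (tr_gen r.1, tr_cogen r.2)) D).
  apply: eq_card => -[A B]; apply/setIdP/imsetP => /=.
    case=> /setXP[/imsetP[p + ->] /imsetP[q + ->]]; rewrite !inE => plt qlt.
    rewrite tr_gen_le_cogen ?(ltW plt) // negbK => H.
    by exists (p, q); rewrite // inE /= (ltW plt) (ltW qlt).
  case=> r /Dlt[plt qlt nle] [-> ->]; split=> //.
  by apply/setXP; split; apply: imset_f; rewrite inE.
move=> [p q] [p' q'] /Dlt[/= p1 p2 _] /Dlt[/= p'1 p'2 _] E; congr pair.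
  by apply: injg (congr1 fst E); rewrite inE.
by apply: injc (congr1 snd E); rewrite inE.
Qed.

End TransferIrreducibles.

(** * Counting squares by intervals *)

Lemma sum_pairE (R : nmodType) (I J : finType) (F : I * J -> R) :
  (\sum_p F p = \sum_i \sum_j F (i, j))%R.
Proof. by rewrite pair_bigA; apply: eq_bigr => -[]. Qed.

Section Counting.
Context {d : Order.disp_t} {L : finLatticeType d}.
Local Open Scope ring_scope.

Definition itv (x z : L) : nat := #|[pred a | (x <= a <= z)%O]|.

Lemma card_itvD (x y z : L) : (x <= y)%O ->
  (#|[pred a | (x <= a <= z)%O && ~~ (y <= a)%O]| + itv y z = itv x z)%N.
Proof.
move=> xy; rewrite addnC [RHS]/itv.
rewrite -(cardID [pred a | (y <= a)%O] [pred a | (x <= a <= z)%O]).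
congr (_ + _)%N; apply: eq_card => a; rewrite !inE; last exact: andbC.
by case: (boolP (y <= a)%O) => [ya|]; rewrite ?andbF // (le_trans xy ya) andbT.
Qed.

(** With x <= y <= z fixed, the corners a left free are those of [x,z] outside
[y,z]. *)
Lemma card_nonlifting_squares :
  #|@nonlifting_squares d L|%:R =
    \sum_x \sum_y \sum_(z : L | (x <= y <= z)%O)
      ((itv x z)%:R - (itv y z)%:R) :> rat.
Proof.
rewrite -sum1_card natr_sum big_mkcond.
rewrite sum_pairE exchange_big sum_pairE /=.
apply: eq_bigr => x _; apply: eq_bigr => y _.
rewrite sum_pairE exchange_big [RHS]big_mkcond; apply: eq_bigr => z _ /=.
case: ifP => [/andP[xy yz]|xyz]; last first.
  apply: big1 => a _; rewrite inE /=.
  by case: and5P => // -[_ xy _ yz _]; rewrite xy yz in xyz.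
rewrite -(card_itvD z xy) natrD addrK -sum1_card natr_sum [RHS]big_mkcond.
apply: eq_bigr => a _; rewrite !inE /= xy yz /=.
by case: (a <= z)%O; case: (x <= a)%O.
Qed.

Lemma card_lt_pairs :
  #|[set p : L * L | (p.1 < p.2)%O]|%:R =
    \sum_(x : L) (#|[pred y | (x <= y)%O]|%:R - 1) :> rat.
Proof.
rewrite -sum1_card natr_sum big_mkcond.
rewrite sum_pairE /=.
apply: eq_bigr => x _; rewrite (cardD1 x) inE lexx natrD addrAC subrr add0r.
rewrite -sum1_card natr_sum [RHS]big_mkcond; apply: eq_bigr => y _.
by rewrite !inE lt_neqAle eq_sym.
Qed.

Lemma codensity_Tr : codensity (Tr L) =
  (\sum_x \sum_y \sum_(z : L | (x <= y <= z)%O)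
     ((itv x z)%:R - (itv y z)%:R))
  / (\sum_(x : L) (#|[pred y | (x <= y)%O]|%:R - 1)) ^+ 2.
Proof. by rewrite codensity_Tr_card card_nonlifting_squares card_lt_pairs. Qed.

End Counting.

(** * Multiplicativity *)

Section FlagSums.
Context {d : Order.disp_t} (L : finLatticeType d).
Local Open Scope ring_scope.

Definition flag_sum (F : L -> L -> L -> rat) : rat :=
  \sum_x \sum_y \sum_(z | (x <= y <= z)%O) F x y z.

(** Splits the numerator into two sums each of which is multiplicative, which
their difference is not. *)
Lemma codensity_flag_sum : codensity (Tr L) =
  (flag_sum (fun x _ z => (itv x z)%:R) - flag_sum (fun _ y z => (itv y z)%:R))
  / (\sum_(x : L) #|[pred y | (x <= y)%O]|%:R - #|L|%:R) ^+ 2.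
Proof.
rewrite codensity_Tr; congr (_ / _ ^+ 2).
  rewrite -sumrB; apply: eq_bigr => x _; rewrite -sumrB.
  by apply: eq_bigr => y _; rewrite -sumrB.
by rewrite sumrB sumr_const.
Qed.

Lemma eq_flag_sum (F G : L -> L -> L -> rat) :
  (forall x y z, (x <= y)%O -> (y <= z)%O -> F x y z = G x y z) ->
  flag_sum F = flag_sum G.
Proof.
move=> FG; apply: eq_bigr => x _; apply: eq_bigr => y _.
by apply: eq_bigr => z /andP[]; exact: FG.
Qed.

End FlagSums.

Section Product.
Context {d1 d2 d3 : Order.disp_t}.
Context {L1 : finLatticeType d1} {L2 : finLatticeType d2}.
Local Open Scope ring_scope.
Local Notation L := (L1 *prod[d3] L2)%type.

Lemma card_prod_up (x : L) :
  #|[pred y | (x <= y)%O]| =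
    (#|[pred y | (x.1 <= y)%O]| * #|[pred y | (x.2 <= y)%O]|)%N.
Proof. by rewrite -cardX; apply: eq_card => y; rewrite !inE leEprod. Qed.

Lemma itv_prod (x z : L) : itv x z = (itv x.1 z.1 * itv x.2 z.2)%N.
Proof.
by rewrite -cardX; apply: eq_card => y; rewrite !inE !leEprod andbACA.
Qed.

Lemma flag_sum_prod (F : L1 -> L1 -> L1 -> rat) (G : L2 -> L2 -> L2 -> rat) :
  @flag_sum _ L (fun x y z => F x.1 y.1 z.1 * G x.2 y.2 z.2) =
  flag_sum F * flag_sum G.
Proof.
rewrite /flag_sum sum_pairE big_distrlr /=.
apply: eq_bigr => x _; apply: eq_bigr => x' _.
rewrite sum_pairE big_distrlr /=.
apply: eq_bigr => y _; apply: eq_bigr => y' _.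
rewrite big_mkcond sum_pairE [in RHS]big_mkcond /= [X in _ * X]big_mkcond.
rewrite big_distrlr /=; apply: eq_bigr => z _; apply: eq_bigr => z' _.
rewrite !leEprod /=; case: (x <= y)%O; case: (x' <= y')%O;
case: (y <= z)%O; case: (y' <= z')%O; by rewrite ?mulr0 ?mul0r.
Qed.

Lemma span_sum_prod :
  @flag_sum _ L (fun x _ z => (itv x z)%:R) =
  @flag_sum _ L1 (fun x _ z => (itv x z)%:R) *
  @flag_sum _ L2 (fun x _ z => (itv x z)%:R).
Proof.
rewrite -(flag_sum_prod (fun x _ z => (itv x z)%:R)
                       (fun x _ z => (itv x z)%:R)).
by apply: eq_flag_sum => x y z _ _; rewrite itv_prod natrM.
Qed.

Lemma upper_sum_prod :
  @flag_sum _ L (fun _ y z => (itv y z)%:R) =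
  @flag_sum _ L1 (fun _ y z => (itv y z)%:R) *
  @flag_sum _ L2 (fun _ y z => (itv y z)%:R).
Proof.
rewrite -(flag_sum_prod (fun _ y z => (itv y z)%:R)
                       (fun _ y z => (itv y z)%:R)).
by apply: eq_flag_sum => x y z _ _; rewrite itv_prod natrM.
Qed.

Lemma up_sum_prod :
  \sum_(x : L) #|[pred y | (x <= y)%O]|%:R =
  (\sum_(x : L1) #|[pred y | (x <= y)%O]|%:R) *
  (\sum_(x : L2) #|[pred y | (x <= y)%O]|%:R) :> rat.
Proof.
rewrite sum_pairE big_distrlr; apply: eq_bigr => x _; apply: eq_bigr => y _.
by rewrite card_prod_up natrM.
Qed.

End Product.

(** * Single chains and products of two chains *)

Section Chains.
Local Open Scope ring_scope.

Lemma card_ord_itv n (a b : nat) : (b < n)%N ->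
  #|[pred c : 'I_n | (a <= c <= b)%N]| = (b.+1 - a)%N.
Proof.
move=> bn; rewrite -sum1_card -(big_mkord (fun i => a <= i <= b)%N (fun=> 1%N)).
rewrite -[RHS]muln1 -sum_nat_const_nat [RHS](big_nat_widen _ _ n) //=.
by rewrite [RHS](big_nat_widenl _ 0%N) //=; apply: eq_bigl => i; rewrite andbC.
Qed.

Lemma card_ord_up n (x : 'I_n.+1) :
  #|[pred y | (x <= y)%O]|%:R = n%:R - x%:R + 1 :> rat.
Proof.
rewrite (eq_card (B := [pred y : 'I_n.+1 | x <= y <= n]%N)) => [|y].
  have xn := ltn_ord x; rewrite ltnS in xn.
  by rewrite card_ord_itv // subSn // -natr1 natrB.
by rewrite !inE leEord [(y <= n)%N]leq_ord andbT.
Qed.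

Lemma itv_ord n (x z : 'I_n.+1) : (x <= z)%O ->
  (itv x z)%:R = z%:R - x%:R + 1 :> rat.
Proof.
rewrite leEord => xz.
rewrite /itv (eq_card (B := [pred y : 'I_n.+1 | x <= y <= z]%N)) //.
by rewrite card_ord_itv // subSn // -natr1 natrB.
Qed.

(** With x innermost and z outermost, a polynomial F has polynomial partial
sums at each stage. *)
Lemma flag_sum_ord n (F : nat -> nat -> nat -> rat) :
  @flag_sum _ 'I_n.+1 (fun x y z => F x y z) =
  \sum_(0 <= z < n.+1) \sum_(0 <= y < z.+1) \sum_(0 <= x < y.+1) F x y z.
Proof.
pose T (x y z : 'I_n.+1) := if (x <= y <= z)%N then F x y z else 0.
transitivity (\sum_x \sum_y \sum_z T x y z).
  by apply: eq_bigr => x _; apply: eq_bigr => y _; rewrite big_mkcond.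
under eq_bigr => x _ do rewrite exchange_big.
rewrite exchange_big big_mkord; apply: eq_bigr => z _; rewrite exchange_big /=.
rewrite big_mkord.
rewrite (big_ord_widen _ (fun y => \sum_(0 <= x < y.+1) F x y z) (ltn_ord z)).
rewrite [RHS]big_mkcond; apply: eq_bigr => y _; rewrite ltnS.
rewrite big_mkord (big_ord_widen _ (fun x => F x y z) (ltn_ord y)).
rewrite [X in if _ then X else _]big_mkcond.
case: ifP => yz; last by apply: big1 => x _; rewrite /T yz andbF.
by apply: eq_bigr => x _; rewrite /T yz andbT ltnS.
Qed.

(** Reduces a closed form to a field identity. *)
Lemma sum_antidifference (f G : nat -> rat) m :
  G 0%N = 0 -> (forall i, G i.+1 = G i + f i) -> \sum_(0 <= i < m) f i = G m.
Proof.
move=> G0 GS; elim: m => [|m IH]; first by rewrite big_nil G0.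
by rewrite big_nat_recr //= IH GS.
Qed.

Lemma span_sum_ord n :
  @flag_sum _ 'I_n.+1 (fun x _ z => z%:R - x%:R + 1) =
  (n%:R + 1) * (n%:R + 2) ^+ 2 * (n%:R + 3) / 12.
Proof.
rewrite (flag_sum_ord n (fun x _ z => z%:R - x%:R + 1)).
rewrite (@sum_antidifference _
  (fun i => i%:R * (i%:R + 1) ^+ 2 * (i%:R + 2) / 12)) => [||z].
- by rewrite -natr1; field.
- by rewrite !mul0r.
rewrite (@sum_antidifference _ (fun i => (z%:R + 1) * i%:R * (i%:R + 1) / 2
    - (i%:R - 1) * i%:R * (i%:R + 1) / 6)) => [||y].
- by rewrite -natr1; field.
- by field.
rewrite (@sum_antidifference _
  (fun i => i%:R * (z%:R + 1) - i%:R * (i%:R - 1) / 2)) => [||x];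
  by rewrite -?natr1; field.
Qed.

Lemma upper_sum_ord n :
  @flag_sum _ 'I_n.+1 (fun _ y z => z%:R - y%:R + 1) =
  (n%:R + 1) * (n%:R + 2) * (n%:R + 3) * (n%:R + 4) / 24.
Proof.
rewrite (flag_sum_ord n (fun _ y z => z%:R - y%:R + 1)).
rewrite (@sum_antidifference _
  (fun i => i%:R * (i%:R + 1) * (i%:R + 2) * (i%:R + 3) / 24)) => [||z].
- by rewrite -natr1; field.
- by rewrite !mul0r.
rewrite (@sum_antidifference _ (fun i => (z%:R + 1) * i%:R * (i%:R + 1) / 2
    - (i%:R - 1) * i%:R * (i%:R + 1) / 3)) => [||y].
- by rewrite -natr1; field.
- by field.
rewrite (@sum_antidifference _
  (fun i => i%:R * (z%:R - y%:R + 1))) => [||x];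
  by rewrite -?natr1; field.
Qed.

Lemma up_sum_ord n :
  \sum_(x < n.+1) (n%:R - x%:R + 1) = (n%:R + 1) * (n%:R + 2) / 2 :> rat.
Proof.
rewrite -(big_mkord predT (fun x => n%:R - x%:R + 1)).
rewrite (@sum_antidifference _
  (fun i => i%:R * (n%:R + 1) - i%:R * (i%:R - 1) / 2)) => [||x];
  by rewrite -?natr1; field.
Qed.

Lemma itv_sum_ord n :
  @flag_sum _ 'I_n.+1 (fun x _ z => (itv x z)%:R) =
    (n%:R + 1) * (n%:R + 2) ^+ 2 * (n%:R + 3) / 12 /\
  @flag_sum _ 'I_n.+1 (fun _ y z => (itv y z)%:R) =
    (n%:R + 1) * (n%:R + 2) * (n%:R + 3) * (n%:R + 4) / 24.
Proof.
rewrite -span_sum_ord -upper_sum_ord; split; apply: eq_bigr => x _;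
  apply: eq_bigr => y _; apply: eq_bigr => z /andP[xy yz].
  by rewrite itv_ord // (le_trans xy yz).
by rewrite itv_ord.
Qed.

Lemma up_card_sum_ord n :
  \sum_(x : 'I_n.+1) #|[pred y | (x <= y)%O]|%:R
    = (n%:R + 1) * (n%:R + 2) / 2 :> rat.
Proof. by rewrite -up_sum_ord; apply: eq_bigr => x _; exact: card_ord_up. Qed.

Lemma codensity_Tr_ord n : (1 <= n)%N -> codensity (Tr 'I_n.+1) =
  (n%:R + 2) * (n%:R + 3) / (6 * n%:R * (n%:R + 1)).
Proof.
move=> n1; have n0 : n%:R != 0 :> rat by rewrite pnatr_eq0 -lt0n.
have n1' : n%:R + 1 != 0 :> rat by rewrite natr1 pnatr_eq0.
rewrite codensity_flag_sum; have [-> ->] := itv_sum_ord n.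
rewrite up_card_sum_ord card_ord -(natr1 n).
(* Factoring the denominator exhibits it as nonzero. *)
have -> : (n%:R + 1) * (n%:R + 2) / 2 - (n%:R + 1)
    = n%:R * (n%:R + 1) / 2 :> rat.
  by field.
by field; rewrite n0 n1'.
Qed.

Lemma codensity_Tr_ord2 n m : (n <> 0 \/ m <> 0)%N ->
  codensity (Tr ('I_n.+1 *p 'I_m.+1)%type) =
    (m%:R + 2) * (m%:R + 3) * (n%:R + 2) * (n%:R + 3)
      * (3 * m%:R * n%:R + 4 * m%:R + 4 * n%:R)
    / (36 * (m%:R + 1) * (n%:R + 1)
         * (2 * m%:R + 2 * n%:R + m%:R * n%:R) ^+ 2).
Proof.
move=> nm; have nm0 : 2 * m%:R + 2 * n%:R + m%:R * n%:R != 0 :> rat.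
  by rewrite -!natrM -!natrD pnatr_eq0; case: n m nm => [|n] [|m] [].
have n1' : n%:R + 1 != 0 :> rat by rewrite natr1 pnatr_eq0.
have m1' : m%:R + 1 != 0 :> rat by rewrite natr1 pnatr_eq0.
rewrite codensity_flag_sum up_sum_prod !up_card_sum_ord.
rewrite span_sum_prod upper_sum_prod.
have [-> ->] := itv_sum_ord n; have [-> ->] := itv_sum_ord m.
rewrite card_prod !card_ord natrM -(natr1 n) -(natr1 m).
have -> : (n%:R + 1) * (n%:R + 2) / 2 * ((m%:R + 1) * (m%:R + 2) / 2)
    - (n%:R + 1) * (m%:R + 1) =
    (n%:R + 1) * (m%:R + 1) * (2 * m%:R + 2 * n%:R + m%:R * n%:R) / 4 :> rat.
  by field.
by field; rewrite n1' m1' nm0.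
Qed.
End Chains.

(** * Products of families of chains *)

Section ChainProducts.
Local Open Scope ring_scope.
Context {k : nat}.

Lemma itv_chain_prod (n : 'I_k -> nat) (x z : chain_prod n) : (x <= z)%O ->
  (itv x z)%:R = \prod_(i < k) ((z i)%:R - (x i)%:R + 1) :> rat.
Proof.
move=> /forallP xz; under eq_bigr => i _ do rewrite -itv_ord //.
rewrite -natr_prod; congr _%:R.
pose F i : pred 'I_(n i).+1 := [pred c | (x i <= c <= z i)%O].
transitivity #|(family F : simpl_pred {dffun forall i, 'I_(n i).+1})|;
  last first.
  by rewrite card_family foldrE big_image.
apply: eq_card.
move=> y; apply/andP/familyP => [[/forallP xy /forallP yz] i|yP].
  by rewrite inE xy yz.
by split; apply/forallP => i; have /andP[] := yP i.
Qed.

Lemma up_chain_prod (n : 'I_k -> nat) (x : chain_prod n) :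
  #|[pred y | (x <= y)%O]|%:R =
  \prod_(i < k) ((n i)%:R - (x i)%:R + 1) :> rat.
Proof.
have le1 (y : chain_prod n) : (y <= [ffun i => ord_max] :> chain_prod n)%O.
  by apply/forallP=> i; rewrite ffunE leEord leq_ord.
have -> : #|[pred y | (x <= y)%O]| = itv x [ffun i => ord_max].
  by apply: eq_card => y; rewrite !inE le1 andbT.
by rewrite itv_chain_prod //; apply: eq_bigr => i _; rewrite ffunE.
Qed.

Lemma codensity_Tr_chain_prod (n : 'I_k -> nat) :
  codensity (Tr (chain_prod n)) =
    (\sum_(x : chain_prod n) \sum_(y : chain_prod n)
      \sum_(z : chain_prod n | [forall i, (x i <= y i <= z i)%N])
        (\prod_(i < k) ((z i)%:R - (x i)%:R + 1)
           - \prod_(i < k) ((z i)%:R - (y i)%:R + 1)))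
    / (\sum_(x : chain_prod n)
         (\prod_(i < k) ((n i)%:R - (x i)%:R + 1) - 1)) ^+ 2.
Proof.
rewrite codensity_Tr; congr (_ / _ ^+ 2); last first.
  by apply: eq_bigr => x _; rewrite up_chain_prod.
apply: eq_bigr => x _; apply: eq_bigr => y _.
apply: eq_big => [z|z /andP[xy yz]].
  apply/andP/forallP => [[/forallP xy /forallP yz] i|xyz].
    by apply/andP; split; [exact: xy | exact: yz].
  by split; apply/forallP => i; have /andP[] := xyz i.
by rewrite !itv_chain_prod // (le_trans xy yz).
Qed.

(** A triple of functions on k is a function on k with values in triples, so the
sum of products is the product of the k equal one-coordinate sums. *)
Lemma flag_sum_cube (m : nat) (F : nat -> nat -> nat -> rat) :
  let P := chain_prod (fun _ : 'I_k => m) in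
  \sum_(x : P) \sum_(y : P)
    \sum_(z : P | [forall i, (x i <= y i <= z i)%N])
      \prod_(i < k) F (x i) (y i) (z i) =
  (@flag_sum _ 'I_m.+1 (fun x y z => F x y z)) ^+ k.
Proof.
move=> P; rewrite -[k in RHS]card_ord -prodr_const /flag_sum bigA_distr_bigA /=.
apply: eq_bigr => x _; rewrite bigA_distr_bigA; apply: eq_bigr => y _ /=.
under [RHS]eq_bigr => i _ do rewrite big_mkcond.
rewrite bigA_distr_bigA big_mkcond; apply: eq_bigr => z _ /=.
case: ifP => [/forallP xyz|/forallPn[i xyz]].
  by apply: eq_bigr => i _; rewrite ifT //; exact: xyz.
by rewrite (bigD1 i) //= ifN ?mul0r.
Qed.

Lemma codensity_Tr_cube :
  codensity (Tr (chain_prod (fun _ : 'I_k => 1%N))) =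
    (6 ^+ k - 5 ^+ k) / (3 ^+ k - 2 ^+ k) ^+ 2.
Proof.
rewrite codensity_Tr_chain_prod; congr (_ / _ ^+ 2).
  under eq_bigr => x _ do under eq_bigr => y _ do rewrite sumrB.
  under eq_bigr => x _ do rewrite sumrB.
  rewrite sumrB (flag_sum_cube 1 (fun x _ z => z%:R - x%:R + 1)).
  rewrite (flag_sum_cube 1 (fun _ y z => z%:R - y%:R + 1)).
  by rewrite span_sum_ord upper_sum_ord; congr (_ ^+ _ - _ ^+ _); field.
rewrite sumrB sumr_const card_ffun !card_ord natrX; congr (_ - _).
transitivity (\prod_(i < k) \sum_(c < 2) (1 - c%:R + 1 : rat)).
  by rewrite bigA_distr_bigA.
by rewrite prodr_const card_ord up_sum_ord; congr (_ ^+ _); field.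
Qed.

End ChainProducts.

Local Open Scope ring_scope.

Theorem theorem3 :
  [/\ forall (k : nat) (n : 'I_k -> nat),
        (1 <= k)%N -> (exists i : 'I_k, n i <> 0%N) ->
        codensity (Tr (chain_prod n)) =
          (\sum_(x : chain_prod n) \sum_(y : chain_prod n)
            \sum_(z : chain_prod n | [forall i, (x i <= y i <= z i)%N])
              (\prod_(i < k) ((z i)%:R - (x i)%:R + 1)
                 - \prod_(i < k) ((z i)%:R - (y i)%:R + 1)))
          / (\sum_(x : chain_prod n)
               (\prod_(i < k) ((n i)%:R - (x i)%:R + 1) - 1)) ^+ 2,
      forall n : nat, (1 <= n)%N ->
        codensity (Tr 'I_n.+1) =
          (n%:R + 2) * (n%:R + 3) / (6 * n%:R * (n%:R + 1)),
      forall n m : nat, (n <> 0 \/ m <> 0)%N ->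
        codensity (Tr ('I_n.+1 *p 'I_m.+1)%type) =
          (m%:R + 2) * (m%:R + 3) * (n%:R + 2) * (n%:R + 3)
            * (3 * m%:R * n%:R + 4 * m%:R + 4 * n%:R)
          / (36 * (m%:R + 1) * (n%:R + 1)
               * (2 * m%:R + 2 * n%:R + m%:R * n%:R) ^+ 2)
    & forall k : nat, (1 <= k)%N ->
        codensity (Tr (chain_prod (fun _ : 'I_k => 1%N))) =
          (6 ^+ k - 5 ^+ k) / (3 ^+ k - 2 ^+ k) ^+ 2].
Proof.
split.
- by move=> k n _ _; exact: codensity_Tr_chain_prod.
- exact: codensity_Tr_ord.
- exact: codensity_Tr_ord2.
- by move=> k _; exact: codensity_Tr_cube.
Qed.
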